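(* Let $k$ be a positive integer. For a partition $\pi$ with largest part $\ell(\pi)$, let $\nu_{d,<k}(\pi)$ be the number of integers $i$ with $1\le i\le \ell(\pi)$ that occur as a part of $\pi$ fewer than $k$ times (the empty partition has $\nu_{d,<k}=0$). For $n\ge0$ let $\nu_{D,<k}(n)=\sum_{\pi}\nu_{d,<k}(\pi)$, the sum over all partitions $\pi$ of $n$. Then, for $|q|<1$, \[ \sum_{n=0}^{\infty}\nu_{D,<k}(n)q^n=\frac{1}{(q;q)_{\infty}}\sum_{\substack{n=1\\ n \neq k}}^{\infty}\frac{q^n}{1-q^n}. \] Consequently, for every $n\ge0$, $\nu_{D,<k}(n)$ equals the total number of parts different from $k$ in all the partitions of $n$ (parts counted with multiplicity).
   Context: Notation: $(q;q)_\infty=\prod_{i\ge1}(1-q^{i})$. *)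

(* Defs.v *)
From mathcomp Require Import all_boot all_order all_algebra.
From mathcomp Require Import all_classical all_reals all_analysis.
From mathcomp Require Import complex.

Set Implicit Arguments.
Unset Strict Implicit.
Unset Printing Implicit Defensive.

Import Order.TTheory GRing.Theory Num.Theory.
Import numFieldNormedType.Exports.

Local Open Scope ring_scope.
Local Open Scope classical_set_scope.
Local Open Scope nat_scope.

(* A partition is the weakly decreasing sequence of its (positive) parts. *)
Definition is_partition (n : nat) (s : seq nat) : bool :=
  [&& sorted geq s, all (ltn 0) s & sumn s == n].

(* A partition of n has at most n parts, each at most n, so bounded sequences
   over 'I_n.+1 enumerate them all; see mem_partitions and partitions_uniq. *)
Definition partitions (n : nat) : seq (seq nat) :=
  [seq s <- [seq [seq val i | i <- t] | t : n.-bseq 'I_n.+1]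
  | is_partition n s].

Lemma mem_partitions (n : nat) (s : seq nat) :
  (s \in partitions n) = is_partition n s.
Proof.
rewrite mem_filter; apply/andb_idr => /and3P[_ s_gt0 /eqP sn].
have size_le : size s <= n.
  rewrite -sn; elim: s s_gt0 {sn} => //= x s IHs /andP[x_gt0 /IHs s_le].
  by rewrite -add1n leq_add.
have part_le x : x \in s -> x <= n.
  rewrite -sn; elim: s {s_gt0 sn size_le} => //= y s IHs.
  rewrite inE => /predU1P[->|/IHs x_le]; first exact: leq_addr.
  exact: leq_trans x_le (leq_addl _ _).
have size_le' : size [seq inord x : 'I_n.+1 | x <- s] <= n by rewrite size_map.
apply/fintype.imageP; exists (Bseq size_le') => //=.
rewrite -map_comp -[LHS]map_id; apply/eq_in_map => x /part_le x_le /=.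
by rewrite inordK.
Qed.

Lemma partitions_uniq (n : nat) : uniq (partitions n).
Proof.
apply/filter_uniq; rewrite map_inj_uniq ?enum_uniq // => t u.
by move/(inj_map val_inj)/val_inj.
Qed.

Definition largest_part (s : seq nat) : nat := \max_(i <- s) i.

Definition nu_lt (k : nat) (s : seq nat) : nat :=
  count (fun i => count_mem i s < k) (index_iota 1 (largest_part s).+1).

Definition nuD_lt (k n : nat) : nat := \sum_(s <- partitions n) nu_lt k s.

Definition nb_parts_neq (k n : nat) : nat :=
  \sum_(s <- partitions n) count (predC1 k) s.

(* The complex numbers over R. The alias is needed because MathComp-Analysis
   attaches its topology to abstract number fields, not to R[i] itself. *)
Definition Cplx (R : realType) : numClosedFieldType := R[i]%C.

Definition qpoch (R : realType) (q : Cplx R) (N : nat) : Cplx R :=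
  (\prod_(1 <= i < N.+1) (1 - q ^+ i))%R.

Definition qpoch_inf (R : realType) (q : Cplx R) : Cplx R := limn (qpoch q).

Definition lambert_neq (R : realType) (k : nat) (q : Cplx R) (N : nat) :
    Cplx R :=
  (\sum_(1 <= n < N.+1 | n != k) q ^+ n / (1 - q ^+ n))%R.

(* Main.v *)
Require Import Defs.
From mathcomp Require Import all_boot all_order all_algebra.
From mathcomp Require Import all_classical all_reals all_analysis.
From mathcomp Require Import complex.

(* Write p(n) for the number of partitions of n.  Inserting m copies of i shows
   that the partitions of n in which i occurs at least m times number
   p(n - m i), which is symmetric in i and m.  Summing over i with m = k, the
   integers occurring at least k times are counted, over all partitions of n,
   as often as the part k occurs; and by conjugation the largest parts have the
   same total as the numbers of parts.  Subtracting gives the second claim.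

   For the series, inserting one part m gives the recurrences
   p_m(n) = p_(m-1)(n) + p_m(n - m), for the number p_m of partitions with
   parts at most m, and t_m(n) = p(n - m) + t_m(n - m), for the number t_m of
   occurrences of m.  They sum to 1 / qpoch q N and to q^m / (1 - q^m) times
   the sum of p(n) q^n; the truncation is then removed by domination by the
   series at |q|, which is bounded because 1 / (1 - x) <= exp (x / (1 - x)). *)

Set Implicit Arguments.
Unset Strict Implicit.
Unset Printing Implicit Defensive.

Import Order.TTheory GRing.Theory Num.Theory.
Import numFieldNormedType.Exports.

(** * Counting partitions *)

Definition add_part (i : nat) (s : seq nat) : seq nat := sort geq (i :: s).

Lemma geq_total : total geq.
Proof. by move=> m n; exact: leq_total. Qed.

Lemma geq_trans : transitive geq.
Proof. by move=> n m p /= nm pn; exact: leq_trans pn nm. Qed.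

Lemma geq_anti : antisymmetric geq.
Proof. by move=> m n /=; rewrite andbC => /anti_leq. Qed.

Lemma perm_add_part i s : perm_eq (add_part i s) (i :: s).
Proof. by rewrite perm_sort. Qed.

Lemma part_le n s x : s \in partitions n -> x \in s -> x <= n.
Proof.
rewrite mem_partitions => /and3P[_ _ /eqP <-] /perm_to_rem/perm_sumn ->.
exact: leq_addr.
Qed.

Lemma part_gt0 n s x : s \in partitions n -> x \in s -> 0 < x.
Proof. by rewrite mem_partitions => /and3P[_ /allP s_gt0 _] /s_gt0. Qed.

Lemma size_partition_le n s : s \in partitions n -> size s <= n.
Proof.
rewrite mem_partitions => /and3P[_ s_gt0 /eqP <-].
elim: s s_gt0 => //= x s IHs /andP[x_gt0 /IHs s_le].
by rewrite -add1n leq_add.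
Qed.

(** A weakly decreasing sequence is determined by its multiset of parts, so partitions are compared
    below only up to permutation. *)
Lemma partition_eq n m s t :
  s \in partitions n -> t \in partitions m -> perm_eq s t -> s = t.
Proof.
rewrite !mem_partitions => /and3P[s_sorted _ _] /and3P[t_sorted _ _].
exact: sorted_eq geq_trans geq_anti _ _ s_sorted t_sorted.
Qed.

Lemma add_part_partition n i s :
  0 < i -> s \in partitions n -> add_part i s \in partitions (n + i).
Proof.
rewrite !mem_partitions => i_gt0 /and3P[_ s_gt0 /eqP sn].
have ps := perm_add_part i s; apply/and3P; split.
- exact/sort_sorted/geq_total.
- by rewrite (perm_all _ ps) /= i_gt0.
- by rewrite (perm_sumn ps) /= sn addnC.
Qed.

Lemma rem_part_partition n i s :
  i \in s -> s \in partitions (n + i) -> rem i s \in partitions n.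
Proof.
rewrite !mem_partitions => si /and3P[s_sorted s_gt0 /eqP sn].
apply/and3P; split.
- exact: subseq_sorted geq_trans _ _ (rem_subseq i s) s_sorted.
- by apply/allP => x /mem_rem; apply/allP.
- by rewrite -(eqn_add2r i) -sn (perm_sumn (perm_to_rem si)) /= addnC.
Qed.

(** Adding a copy of [i] and removing one are mutually inverse bijections. *)
Lemma perm_partitions_add_part n i : 0 < i ->
  perm_eq [seq s <- partitions (n + i) | i \in s]
          [seq add_part i s | s <- partitions n].
Proof.
move=> i_gt0; apply: uniq_perm.
- exact/filter_uniq/partitions_uniq.
- rewrite map_inj_in_uniq ?partitions_uniq // => s t sn tn st.
  apply: (partition_eq sn tn); rewrite -(perm_cons i).
  by rewrite -(permPl (perm_add_part i s)) st perm_add_part.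
move=> s; rewrite mem_filter; apply/andP/mapP => [[si sn]|[t tn ->]].
  exists (rem i s); first exact: rem_part_partition.
  have rn := rem_part_partition si sn.
  apply: (partition_eq sn (add_part_partition i_gt0 rn)).
  by rewrite (permPl (perm_to_rem si)) perm_sym perm_add_part.
by rewrite add_part_partition // (perm_mem (perm_add_part i t)) mem_head.
Qed.

Lemma sum_partitions_mem (F : seq nat -> nat) n i : 0 < i ->
  \sum_(s <- partitions (n + i) | i \in s) F s =
  \sum_(s <- partitions n) F (add_part i s).
Proof.
move=> i_gt0; rewrite -big_filter.
by rewrite (perm_big _ (perm_partitions_add_part n i_gt0)) big_map.
Qed.

Lemma sum_partitions_mem_lt (F : seq nat -> nat) n i : n < i ->
  \sum_(s <- partitions n | i \in s) F s = 0.
Proof.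
move=> lt_ni; rewrite big_seq_cond big1 // => s /andP[sn /(part_le sn)].
by rewrite leqNgt lt_ni.
Qed.

(** * Counting functions and their recurrences *)

Definition npart (n : nat) : nat := size (partitions n).

Definition npart_mult_ge (i k n : nat) : nat :=
  \sum_(s <- partitions n) (k <= count_mem i s).

(** These will be the coefficients of the power series of [(qpoch q N)^-1]. *)
Definition npart_le (N n : nat) : nat :=
  \sum_(s <- partitions n) all (leq^~ N) s.

Definition nb_parts_eq (m n : nat) : nat :=
  \sum_(s <- partitions n) count_mem m s.

Lemma sum_partitions1 n : \sum_(s <- partitions n) 1 = npart n.
Proof. by rewrite sum1_size. Qed.

Lemma count_mem_add_part i j s :
  count_mem i (add_part j s) = (j == i) + count_mem i s.
Proof. by rewrite (permP (perm_add_part j s)). Qed.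

(** Removing one copy of [i] turns at least [k.+1] copies in a partition of [n] into at least [k]
    copies in one of [n - i]; induct on [k]. *)
Lemma npart_mult_geE i k n : 0 < i ->
  npart_mult_ge i k n = if k * i <= n then npart (n - k * i) else 0.
Proof.
move=> i_gt0; elim: k n => [|k IHk] n; first by rewrite subn0 -sum_partitions1.
have -> : npart_mult_ge i k.+1 n =
    \sum_(s <- partitions n | i \in s) (k < count_mem i s).
  rewrite /npart_mult_ge [RHS]big_mkcond; apply: eq_bigr => s _.
  by case: ifPn => // /count_memPn ->.
have [lt_ni|le_in] := ltnP n i.
  rewrite sum_partitions_mem_lt // ifN // -ltnNge.
  by rewrite (leq_trans lt_ni) // mulSn leq_addr.
rewrite -(subnK le_in) sum_partitions_mem //.
under eq_bigr => s _ do rewrite count_mem_add_part eqxx add1n ltnS.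
rewrite -/(npart_mult_ge i k (n - i)) IHk mulSnr leq_add2r.
by rewrite subnDr.
Qed.

Lemma nb_parts_eqE m n : 0 < m ->
  nb_parts_eq m n =
  if m <= n then npart (n - m) + nb_parts_eq m (n - m) else 0.
Proof.
move=> m_gt0.
have -> : nb_parts_eq m n = \sum_(s <- partitions n | m \in s) count_mem m s.
  rewrite [RHS]big_mkcond; apply: eq_bigr => s _.
  by case: ifPn => // /count_memPn ->.
have [lt_nm|le_mn] := ltnP n m; first exact: sum_partitions_mem_lt.
rewrite -{1}(subnK le_mn) sum_partitions_mem //.
under eq_bigr => s _ do rewrite count_mem_add_part eqxx.
by rewrite big_split sum_partitions1.
Qed.

Lemma npart_le0 n : npart_le 0 n = (n == 0).
Proof.
rewrite /npart_le; have [->|n_neq0] := eqVneq n 0.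
  rewrite (perm_big [:: [::]]) ?big_seq1 //; apply: uniq_perm => // [|s].
    exact: partitions_uniq.
  rewrite mem_partitions inE; case: s => // x s; apply/negbTE/negP.
  by case/and3P=> _ /andP[x_gt0 _]; rewrite /= addn_eq0; case: x x_gt0.
rewrite big_seq big1 // => -[|x s] sn.
  move: sn; rewrite mem_partitions => /and3P[_ _ /eqP n0].
  by rewrite -n0 in n_neq0.
by rewrite /= leqNgt (part_gt0 sn (mem_head x s)).
Qed.

(** Split on whether [N.+1] occurs: if not, all parts are at most [N]; if so, remove one copy. *)
Lemma npart_leS N n : npart_le N.+1 n =
  npart_le N n + if N.+1 <= n then npart_le N.+1 (n - N.+1) else 0.
Proof.
rewrite /npart_le.
transitivity (npart_le N n +
    \sum_(s <- partitions n | N.+1 \in s) all (leq^~ N.+1) s).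
  rewrite /npart_le [X in _ + X]big_mkcond -big_split; apply: eq_bigr => s _ /=.
  case: ifPn => [sN|sN]; last first.
    rewrite addn0; congr nat_of_bool; apply/eq_in_all => x sx /=.
    by rewrite leq_eqVlt ltnS; case: eqVneq => // xN; rewrite -xN sx in sN.
  suff /negbTE -> : ~~ all (leq^~ N) s by [].
  by apply/allPn; exists N.+1 => //=; rewrite ltnn.
congr addn; have [lt_nN|le_Nn] := ltnP n N.+1.
  exact: sum_partitions_mem_lt.
rewrite -{1}(subnK le_Nn) sum_partitions_mem //; apply: eq_bigr => s _.
by rewrite (perm_all _ (perm_add_part _ s)) /= leqnn.
Qed.

Lemma npart_le_leq N n : npart_le N n <= npart n.
Proof. by rewrite -sum_partitions1; apply: leq_sum => s _; exact: leq_b1. Qed.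

Lemma npart_le_full N n : n <= N -> npart_le N n = npart n.
Proof.
move=> le_nN; rewrite -sum_partitions1 /npart_le big_seq [RHS]big_seq.
apply: eq_bigr => s sn; case: allP => // -[] x sx.
exact: leq_trans (part_le sn sx) le_nN.
Qed.

(** Truncation matching [lambert_neq k q N]: only part sizes up to [N] are counted. *)
Definition nb_parts_neq_le (k N n : nat) : nat :=
  \sum_(1 <= m < N.+1 | m != k) nb_parts_eq m n.

Lemma count_sum_mem (P : pred nat) n s : s \in partitions n ->
  count P s = \sum_(1 <= m < n.+1 | P m) count_mem m s.
Proof.
move=> sn; rewrite -sum1_count.
under [RHS]eq_bigr => m _ do rewrite -sum1_count big_mkcond.
rewrite exchange_big /= big_mkcond big_seq [RHS]big_seq.
apply: eq_bigr => x sx; rewrite -big_mkcondr /=.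
case: ifPn => Px; last first.
  rewrite big_pred0 // => m.
  by case: eqP => [<-|]; rewrite ?(negPf Px) ?andbF.
rewrite (eq_bigl (pred1 x)) => [|m /=]; last first.
  by rewrite eq_sym; case: eqP => [->|]; rewrite ?Px ?andbF.
rewrite -big_filter filter_pred1_uniq ?big_seq1 ?iota_uniq //.
by rewrite mem_index_iota (part_gt0 sn sx) ltnS (part_le sn sx).
Qed.

Lemma nb_parts_neqE k n : nb_parts_neq k n = nb_parts_neq_le k n n.
Proof.
rewrite /nb_parts_neq_le exchange_big /= /nb_parts_neq big_seq [RHS]big_seq.
by apply: eq_bigr => s /count_sum_mem ->.
Qed.

Lemma nb_parts_neq_le_full k N n :
  n <= N -> nb_parts_neq_le k N n = nb_parts_neq k n.
Proof.
move=> le_nN; rewrite nb_parts_neqE /nb_parts_neq_le.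
rewrite (@big_cat_nat _ _ _ n.+1) //=.
rewrite [X in _ + X]big_nat_cond [X in _ + X]big1 ?addn0 // => m.
case/andP=> /andP[lt_nm _] _; rewrite nb_parts_eqE ?(leq_trans _ lt_nm) //.
by rewrite leqNgt lt_nm.
Qed.

Lemma nb_parts_neq_le_leq k N n : nb_parts_neq_le k N n <= nb_parts_neq k n.
Proof.
have [/nb_parts_neq_le_full -> //|/ltnW le_Nn] := leqP n N.
rewrite nb_parts_neqE /nb_parts_neq_le.
by rewrite [leqRHS](@big_cat_nat _ _ _ N.+1) ?leq_addr.
Qed.

(** * Conjugation: entry [i] is the length of column [i] of the Ferrers diagram *)

Definition conj_part (s : seq nat) : seq nat :=
  [seq count (ltn i) s | i <- iota 0 (largest_part s)].

Lemma le_largest_part s x : x \in s -> x <= largest_part s.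
Proof. by move=> sx; rewrite /largest_part (big_rem x) //= leq_maxl. Qed.

Lemma count_gt_largest_part s i :
  (0 < count (ltn i) s) = (i < largest_part s).
Proof.
rewrite -has_count; apply/hasP/idP => [[x sx /= lt_ix]|lt_is].
  exact: leq_trans lt_ix (le_largest_part sx).
case: (boolP (has (ltn i) s)) => [/hasP //|/hasPn s_le].
move: lt_is; rewrite ltnNge => /negP[]; apply/bigmax_leqP_seq => x sx _.
by rewrite leqNgt s_le.
Qed.

(** Column lengths decrease with [i] and are positive for [i] below the largest part; exchanging the
    sums counts the cells by rows instead of columns. *)
Lemma conj_part_partition n s :
  s \in partitions n -> conj_part s \in partitions n.
Proof.
rewrite !mem_partitions => /and3P[_ _ /eqP <-]; apply/and3P; split.
- rewrite sorted_map; apply: (@sub_sorted _ leq) (iota_sorted _ _) => i j le_ij.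
  by apply: sub_count => x; exact: leq_ltn_trans.
- rewrite all_map; apply/allP => i; rewrite mem_iota add0n /= => lt_is.
  by rewrite count_gt_largest_part.
rewrite sumnE big_map -{1}(subn0 (largest_part s)) -/(index_iota 0 _).
under eq_bigr => i _ do rewrite -sum1_count big_mkcond.
rewrite exchange_big sumnE /= big_seq [X in _ == X]big_seq.
apply/eqP/eq_bigr => x /le_largest_part le_xs.
rewrite (@big_cat_nat _ _ _ x) //= [X in _ + X]big_nat_cond [X in _ + X]big1.
  rewrite addn0 big_nat (eq_bigr (fun=> 1)) => [|i /andP[_ ->] //].
  by rewrite -big_nat sum_nat_const_nat subn0 muln1.
by move=> i /andP[/andP[le_xi _] _]; rewrite ltnNge le_xi.
Qed.

Lemma conj_part_inj n : {in partitions n &, injective conj_part}.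
Proof.
move=> s t sn tn st; apply: (partition_eq sn tn).
have eqL : largest_part s = largest_part t.
  by have := congr1 size st; rewrite /conj_part !size_map !size_iota.
have eqc i : count (ltn i) s = count (ltn i) t.
  have [lt_is|] := ltnP i (largest_part s).
    have := congr1 (nth 0 ^~ i) st; rewrite /conj_part.
    by rewrite -eqL !(nth_map 0) ?size_iota // !nth_iota.
  move=> le_si; transitivity 0.
    by apply/eqP; rewrite -leqn0 leqNgt count_gt_largest_part -leqNgt.
  by apply/esym/eqP; rewrite -leqn0 leqNgt count_gt_largest_part -leqNgt -eqL.
have countS u i : count (ltn i) u = count_mem i.+1 u + count (ltn i.+1) u.
  elim: u => //= x u ->; rewrite addnACA; congr addn.
  by rewrite leq_eqVlt eq_sym; case: eqVneq => [->|]; rewrite ?ltnn.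
apply/allP => x; rewrite mem_cat => x_in /=; apply/eqP.
have : 0 < x by case/orP: x_in; apply: part_gt0; eassumption.
case: x {x_in} => // i _; apply/eqP; rewrite -(eqn_add2r (count (ltn i.+1) s)).
by rewrite -countS eqc countS eqc.
Qed.

(** An injection of a finite list into itself permutes it, and the conjugate of [s] has
    [largest_part s] parts. *)
Lemma sum_largest_part n :
  \sum_(s <- partitions n) largest_part s = \sum_(s <- partitions n) size s.
Proof.
have uc : uniq (map conj_part (partitions n)).
  by rewrite map_inj_in_uniq ?partitions_uniq //; exact: conj_part_inj.
have sc : {subset map conj_part (partitions n) <= partitions n}.
  by move=> _ /mapP[s sn ->]; exact: conj_part_partition.
have [|_ eqc] := uniq_min_size uc sc; first by rewrite size_map.
rewrite -[RHS](perm_big _ (uniq_perm uc (partitions_uniq n) eqc)) big_map.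
by apply: eq_bigr => s _; rewrite /conj_part size_map size_iota.
Qed.

(** * The combinatorial identity *)

Lemma nu_ltD k n s : 0 < k -> s \in partitions n ->
  nu_lt k s + \sum_(1 <= i < n.+1) (k <= count_mem i s) = largest_part s.
Proof.
move=> k_gt0 sn.
have le_sn : largest_part s <= n.
  by apply/bigmax_leqP_seq => x sx _; exact: part_le sn sx.
rewrite (@big_cat_nat _ _ _ (largest_part s).+1) //=.
rewrite [X in _ + (_ + X)]big_nat_cond [X in _ + (_ + X)]big1 => [|i].
  rewrite addn0 /nu_lt -sum1_count big_mkcond -big_split /=.
  rewrite (eq_bigr (fun=> 1)) => [|i _].
    by rewrite sum_nat_const_nat muln1 subn1.
  by case: ltnP.
(* An [i] beyond the largest part occurs 0 times, which is fewer than [k] since [k] is positive. *)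
case/andP=> /andP[lt_si _] _; rewrite (count_memPn _) ?leqn0 ?gtn_eqF //.
by apply: contraL lt_si => /le_largest_part; rewrite -leqNgt.
Qed.

Lemma sum_nat_leq m n : m <= n -> \sum_(1 <= j < n.+1) (j <= m) = m.
Proof.
move=> le_mn; rewrite (@big_cat_nat _ _ _ m.+1) //=.
rewrite [X in _ + X]big_nat_cond [X in _ + X]big1 => [|j].
  rewrite addn0 big_nat (eq_bigr (fun=> 1)) => [|j /andP[_]]; last first.
    by rewrite ltnS => ->.
  by rewrite -big_nat sum_nat_const_nat muln1 subn1.
by case/andP=> /andP[lt_mj _] _; rewrite leqNgt lt_mj.
Qed.

Lemma nuD_ltE k n : 0 < k -> nuD_lt k n = nb_parts_neq k n.
Proof.
move=> k_gt0; apply/eqP; rewrite -(eqn_add2r (nb_parts_eq k n)); apply/eqP.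
(* Once the occurrences of [k] are added, both sides become the total number of parts. *)
transitivity (\sum_(s <- partitions n) size s); last first.
  rewrite /nb_parts_neq /nb_parts_eq -big_split; apply: eq_bigr => s _ /=.
  by rewrite addnC count_predC.
(* A multiplicity is the number of [i >= 1] not exceeding it, so occurrences of [k] are counted by
   having at least [i] copies of [k]; by symmetry of [i * k] this equals having at least [k] copies
   of [i]. *)
have -> : nb_parts_eq k n = \sum_(1 <= i < n.+1) npart_mult_ge i k n.
  rewrite big_nat.
  rewrite (eq_bigr (fun i => npart_mult_ge k i n)) => [|i /andP[i_gt0 _]].
    rewrite -big_nat exchange_big /nb_parts_eq big_seq [RHS]big_seq /=.
    apply: eq_bigr => s sn; rewrite sum_nat_leq //.
    exact: leq_trans (count_size _ _) (size_partition_le sn).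
  by rewrite !npart_mult_geE // mulnC.
rewrite -sum_largest_part exchange_big -big_split big_seq [RHS]big_seq /=.
by apply: eq_bigr => s; exact: nu_ltD.
Qed.

(** * Power series with natural coefficients over the complex numbers *)

Local Open Scope classical_set_scope.
Local Open Scope ring_scope.

Import ComplexField.Normc.

(** * The real-valued modulus and convergence in [Cplx R] *)

Section ModulusOnCplx.
Variable R : realType.
Implicit Types x y : Cplx R.

(** The norm takes values in [Cplx R] itself; estimates are made with the real-valued [normc]. *)
Lemma normC_normc x : `|x| = (normc x)%:C%C. Proof. by []. Qed.

Lemma normc_ge0 x : 0 <= normc x.
Proof. by rewrite -ler0c -normC_normc. Qed.

Lemma ler_normcD x y : normc (x + y) <= normc x + normc y.
Proof. exact: le_normcD. Qed.

Lemma ler_normc_sum (I : Type) (s : seq I) (P : pred I) (F : I -> Cplx R) :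
  normc (\sum_(i <- s | P i) F i) <= \sum_(i <- s | P i) normc (F i).
Proof.
elim/big_ind2 : _ => [|x1 x2 y1 y2 le_x le_y|//]; first by rewrite normc0.
exact: le_trans (ler_normcD _ _) (lerD le_x le_y).
Qed.

Lemma normcX x n : normc (x ^+ n) = normc x ^+ n.
Proof. by elim: n => [|n IHn]; rewrite ?normc1 // !exprS normcM IHn. Qed.

Lemma normc_nat n : normc (n%:R : Cplx R) = n%:R.
Proof. by apply: complexI; rewrite -normC_normc normr_nat rmorph_nat. Qed.

Lemma normc_Re_Im x : normc x <= `|complex.Re x| + `|complex.Im x|.
Proof.
rewrite [normc x](_ : _ = Num.sqrt (complex.Re x ^+ 2 + complex.Im x ^+ 2)).
  rewrite -[leRHS]ger0_norm ?addr_ge0 // -[leRHS]sqrtr_sqr ler_sqrt ?sqr_ge0 //.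
  by rewrite sqrrD !real_normK ?num_real // lerD2r lerDl mulrn_wge0 ?mulr_ge0.
by case: x.
Qed.

Lemma normr_Re_le x : `|complex.Re x| <= normc x.
Proof. by rewrite -lecR; exact: normc_ge_Re. Qed.

Lemma normr_Im_le x : `|complex.Im x| <= normc x.
Proof.
case: x => a b /=; rewrite -sqrtr_sqr ler_wsqrtr // lerDr sqr_ge0 //.
Qed.

Lemma cvgC_distP (u : nat -> Cplx R) (l : Cplx R) :
  u @ \oo --> l <->
  (forall e : R, 0 < e -> \forall n \near \oo, normc (l - u n) < e).
Proof.
split=> [/cvgrPdist_lt ul e e_gt0|ul].
  have eC_gt0 : (0 : Cplx R) < e%:C%C by rewrite ltcR.
  by apply: filterS (ul _ eC_gt0) => n; rewrite normC_normc ltcR.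
(* A positive element of [Cplx R] has zero imaginary part, so real radii suffice. *)
apply/cvgrPdist_lt => e; rewrite ltcE => /andP[/eqP Im_e /ul Re_e].
apply: filterS Re_e => n lt_e; rewrite normC_normc ltcE /= lt_e andbT.
exact/eqP.
Qed.

Lemma normc_lim_le (u : nat -> Cplx R) (l : Cplx R) (c : R) :
  u @ \oo --> l -> (\forall n \near \oo, normc (u n) <= c) -> normc l <= c.
Proof.
move=> /cvgC_distP ul u_le; apply/ler_addgt0Pl => e /ul lu.
have [n [/ltW lt_e le_c]] := filter_ex (filterI lu u_le).
rewrite -[l](subrK (u n)).
exact: le_trans (ler_normcD _ _) (lerD lt_e le_c).
Qed.

End ModulusOnCplx.

(** * Partial sums of power series and domination *)

Section PowerSeries.

(** The ring is arbitrary so that the same sums serve at [q] and at the real number [normc q]. *)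
Definition psum (K : pzRingType) (a : nat -> nat) (x : K) (M : nat) : K :=
  \sum_(0 <= n < M) (a n)%:R * x ^+ n.

Definition delay (m : nat) (a : nat -> nat) (n : nat) : nat :=
  if (m <= n)%N then a (n - m)%N else 0%N.

Lemma psum_delay (K : comPzRingType) m a (x : K) M :
  psum (delay m a) x M = x ^+ m * psum a x (M - m).
Proof.
rewrite /psum /delay; have [lt_Mm|le_mM] := ltnP M m.
  (* Truncated subtraction gives 0 here, and both sides vanish. *)
  rewrite (_ : (M - m)%N = 0%N); last by apply/eqP; rewrite subn_eq0 ltnW.
  rewrite [in RHS]big_geq // mulr0 big_nat big1 // => n /andP[_ lt_nM].
  by rewrite ifN ?mul0r // -ltnNge (ltn_trans lt_nM).
rewrite (big_cat_nat (n:=m)) //= big_nat big1 => [|n /andP[_ lt_nm]]; last first.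
  by rewrite leqNgt lt_nm mul0r.
rewrite add0r -{1}[m]add0n big_addn mulr_sumr; apply: eq_bigr => n _.
by rewrite leq_addl addnK exprD mulrA mulrC.
Qed.

Lemma psumD (K : pzRingType) a b (x : K) M :
  psum (fun n => a n + b n)%N x M = psum a x M + psum b x M.
Proof. by rewrite -big_split; apply: eq_bigr => n _; rewrite natrD mulrDl. Qed.

Lemma eq_psum (K : pzRingType) a b (x : K) M :
  a =1 b -> psum a x M = psum b x M.
Proof. by move=> ab; apply: eq_bigr => n _; rewrite ab. Qed.

Lemma psum_sum (K : pzRingType) I (s : seq I) (P : pred I) a (x : K) M :
  psum (fun n => \sum_(i <- s | P i) a i n)%N x M =
  \sum_(i <- s | P i) psum (a i) x M.
Proof.
by rewrite exchange_big; apply: eq_bigr => n _; rewrite natr_sum mulr_suml.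
Qed.

Lemma psum_ge0 (K : numDomainType) a (x : K) M : 0 <= x -> 0 <= psum a x M.
Proof.
by move=> x_ge0; apply: sumr_ge0 => n _; rewrite mulr_ge0 ?exprn_ge0.
Qed.

Lemma ler_psum (K : numDomainType) a (x : K) M N :
  0 <= x -> (M <= N)%N -> psum a x M <= psum a x N.
Proof.
move=> x_ge0 le_MN; rewrite /psum (big_cat_nat (n:=M) (p:=N)) //= lerDl.
by apply: sumr_ge0 => n _; rewrite mulr_ge0 ?exprn_ge0.
Qed.

Variable R : realType.
Implicit Types (q : Cplx R) (r : R).

Definition psum_bounded a r := exists C, forall M, psum a r M <= C.

Lemma psum_real_cvg a r : 0 <= r -> psum_bounded a r -> cvgn (psum a r).
Proof.
move=> r_ge0 [C aC]; apply: nondecreasing_is_cvgn.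
  by move=> M N; exact: ler_psum.
by exists C => _ [M _ <-].
Qed.

(** The partial sums increase to their limit, which bounds every [psum a r M]; hence one [N] works
    for all [M]. *)
Lemma psum_real_cauchy a r (e : R) : 0 <= r -> psum_bounded a r -> 0 < e ->
  \forall N \near \oo, forall M, psum a r M - psum a r N <= e.
Proof.
move=> r_ge0 ar e_gt0; have ca := psum_real_cvg r_ge0 ar.
have /cvgrPdist_lt /(_ e e_gt0) := ca; apply: filterS => N lt_e M.
apply: le_trans (ltW (le_lt_trans (ler_norm _) lt_e)).
rewrite lerD2r; apply: nondecreasing_cvgn_le => //.
by move=> i j; exact: ler_psum.
Qed.

(** The first [N] terms cancel, and each later coefficient [a n - b n] lies between 0 and [a n]. *)
Lemma normc_psumB a b q M N : (N <= M)%N ->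
  (forall n, (b n <= a n)%N) -> (forall n, (n < N)%N -> b n = a n) ->
  normc (psum a q M - psum b q M) <=
    psum a (normc q) M - psum a (normc q) N.
Proof.
move=> le_NM le_ba eq_ba; rewrite /psum (big_cat_nat (n:=N) (p:=M)) //=.
have -> : \sum_(0 <= n < M) (b n)%:R * q ^+ n =
    \sum_(0 <= n < N) (a n)%:R * q ^+ n + \sum_(N <= n < M) (b n)%:R * q ^+ n.
  rewrite (big_cat_nat (n:=N)) //=; congr (_ + _).
  by apply: eq_big_nat => n /andP[_ /eq_ba ->].
rewrite opprD addrACA subrr add0r -sumrB.
apply: le_trans (ler_normc_sum _ _ _) _.
rewrite [X in _ <= X - _](big_cat_nat (n:=N)) //= addrAC subrr add0r.
apply: ler_sum => n _; rewrite -mulrBl -natrB // normcM normc_nat normcX.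
by rewrite ler_wpM2r ?exprn_ge0 ?normc_ge0 // ler_nat leq_subr.
Qed.

Lemma psum_cvg a q : psum_bounded a (normc q) ->
  exists l : Cplx R, psum a q @ \oo --> l.
Proof.
move=> /(psum_real_cvg (normc_ge0 q)) ca.
(* With [f] the real or the imaginary part, the series is dominated termwise by the one at
   [normc q]. *)
have cvg_part (f : Cplx R -> R) : {morph f : x y / x + y} -> f 0 = 0 ->
    (forall x, `|f x| <= normc x) -> cvgn (fun M => f (psum a q M)).
  move=> fD f0 f_le.
  pose t n := f ((a n)%:R * q ^+ n).
  rewrite (_ : (fun M => _) = series t); last first.
    by apply/funext => M; rewrite /psum (big_morph f fD f0).
  apply: (@normed_cvg R R).
  apply: (@series_le_cvg _ _ (fun n => (a n)%:R * normc q ^+ n)) => //= n.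
    by rewrite mulr_ge0 ?exprn_ge0 ?normc_ge0.
  by rewrite (le_trans (f_le _)) // normcM normc_nat normcX.
have ReD : {morph @complex.Re R : x y / x + y} by case=> [? ?] [? ?].
have ImD : {morph @complex.Im R : x y / x + y} by case=> [? ?] [? ?].
have /cvgrPdist_lt cRe := cvg_part _ ReD erefl (@normr_Re_le R).
have /cvgrPdist_lt cIm := cvg_part _ ImD erefl (@normr_Im_le R).
eexists (Complex _ _); apply/cvgC_distP => e e_gt0.
have e2_gt0 : 0 < e / 2 by rewrite divr_gt0.
near=> n; rewrite [e]splitr; apply: le_lt_trans (normc_Re_Im _) _.
rewrite [psum a q n](_ : _ = Complex (complex.Re (psum a q n))
                                     (complex.Im (psum a q n))); last first.
  by case: (psum a q n).
apply: ltrD => /=; near: n; [exact: cRe|exact: cIm].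
Unshelve. all: by end_near. Qed.

(** Dominated convergence: [F N] differs from the full sum by at most the tail from [N] on of the
    series of [a] at [normc q]. *)
Lemma psum_cvg_dominated (aN : nat -> nat -> nat) a q (F : nat -> Cplx R) :
  (forall N n, (aN N n <= a n)%N) -> (forall N n, (n <= N)%N -> aN N n = a n) ->
  psum_bounded a (normc q) -> (forall N, psum (aN N) q @ \oo --> F N) ->
  exists2 l : Cplx R, psum a q @ \oo --> l & F @ \oo --> l.
Proof.
move=> aN_le aN_eq a_bd cF; have [l cl] := psum_cvg a_bd; exists l => //.
apply/cvgC_distP => e e_gt0.
have e2_gt0 : 0 < e / 2 by rewrite divr_gt0.
have := psum_real_cauchy (normc_ge0 q) a_bd e2_gt0; apply: filterS => N tail.
(* The limit in [M] preserves only a weak inequality, hence the bound by [e / 2]. *)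
apply: le_lt_trans (_ : _ <= e / 2) _; last first.
  by rewrite ltr_pdivrMr // ltr_pMr // ltr1n.
apply: (normc_lim_le (cvgB cl (cF N))).
exists N => // M /= le_NM; apply: le_trans (tail M).
by apply: normc_psumB => // n /ltnW; exact: aN_eq.
Qed.

End PowerSeries.

(** * The generating functions *)

Section Recurrences.
Variable R : realType.
Implicit Types (q : Cplx R) (r : R).

(** The delayed sum stops at [M - m]; extending it to [M] only increases it, which leaves an
    inequality. *)
Lemma psum_divr_le (a b : nat -> nat) m r M :
  0 <= r < 1 -> (0 < m)%N -> (forall n, b n = a n + delay m b n)%N ->
  psum b r M <= psum a r M / (1 - r ^+ m).
Proof.
move=> /andP[r_ge0 r_lt1] m_gt0 bE.
rewrite ler_pdivlMr ?subr_gt0 ?exprn_ilt1 -?lt0n //.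
rewrite mulrBr mulr1 lerBlDr {1}(eq_psum _ _ bE) psumD psum_delay lerD2l.
by rewrite [leRHS]mulrC ler_wpM2l ?exprn_ge0 ?ler_psum ?leq_subr.
Qed.

Lemma psum_bounded_div (a b : nat -> nat) m r :
  0 <= r < 1 -> (0 < m)%N -> (forall n, b n = a n + delay m b n)%N ->
  psum_bounded a r -> psum_bounded b r.
Proof.
move=> r01 m_gt0 bE [C aC]; exists (C / (1 - r ^+ m)) => M.
apply: le_trans (psum_divr_le M r01 m_gt0 bE) _.
case/andP: r01 => r_ge0 r_lt1.
by rewrite ler_wpM2r // invr_ge0 subr_ge0 exprn_ile1 // ltW.
Qed.

Lemma psum_delay_cvg a m q (A : Cplx R) :
  psum a q @ \oo --> A -> psum (delay m a) q @ \oo --> q ^+ m * A.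
Proof.
move=> cA; rewrite (_ : psum _ _ = fun M => q ^+ m * psum a q (M - m)).
  by apply: cvgMl_tmp; rewrite cvg_centern.
by apply/funext => M; rewrite psum_delay.
Qed.

Lemma subr1X_neq0 q m : normc q < 1 -> (0 < m)%N -> 1 - q ^+ m != 0.
Proof.
move=> q_lt1 m_gt0; rewrite subr_eq0; apply/eqP => qm.
have : normc (q ^+ m) < 1 by rewrite normcX exprn_ilt1 ?normc_ge0 // -lt0n.
by rewrite -qm normc1 ltxx.
Qed.

(** Boundedness first gives a limit [B]; the recurrence then forces [B = A + q ^+ m * B]. *)
Lemma psum_div_cvg (a b : nat -> nat) m q (A : Cplx R) :
  normc q < 1 -> (0 < m)%N -> (forall n, b n = a n + delay m b n)%N ->
  psum_bounded a (normc q) -> psum a q @ \oo --> A ->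
  psum b q @ \oo --> A / (1 - q ^+ m).
Proof.
move=> q_lt1 m_gt0 bE a_bd cA.
have r01 : 0 <= normc q < 1 by rewrite normc_ge0.
have [B cB] := psum_cvg (psum_bounded_div r01 m_gt0 bE a_bd).
suff -> : A / (1 - q ^+ m) = B by [].
apply: (canLR (mulfK (subr1X_neq0 q_lt1 m_gt0))).
rewrite mulrBr mulr1; apply/eqP; rewrite eq_sym subr_eq; apply/eqP.
rewrite [B * _]mulrC; apply: (norm_cvg_unique cB).
rewrite (_ : psum b q = psum a q \+ psum (delay m b) q).
  exact: cvgD cA (psum_delay_cvg cB).
by apply/funext => M /=; rewrite -psumD; exact: eq_psum.
Qed.

Lemma sum_exp_le r N : 0 <= r < 1 ->
  \sum_(1 <= i < N.+1) r ^+ i <= (1 - r)^-1.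
Proof.
case/andP=> r_ge0 r_lt1; rewrite -[leRHS]mul1r ler_pdivlMr ?subr_gt0 //.
(* This sharper bound is the one that passes through the induction. *)
apply: (@le_trans _ _ (1 - r ^+ N.+1)); last by rewrite gerBl exprn_ge0.
elim: N => [|N IHN].
  by rewrite big_geq // mul0r subr_ge0 exprn_ile1 // ltW.
rewrite big_nat_recr //= mulrDl; apply: le_trans (lerD IHN (lexx _)) _.
by rewrite mulrBr mulr1 -exprSr addrA subrK.
Qed.

End Recurrences.

(** * Euler's product for the partition function *)

Section Euler.
Variable R : realType.
Implicit Types (q : Cplx R) (r : R).

Lemma npart_le_delay N n :
  npart_le N.+1 n = (npart_le N n + delay N.+1 (npart_le N.+1) n)%N.
Proof. exact: npart_leS. Qed.

(** With [x = r ^+ N.+1 <= r], the new factor is [1 / (1 - x) = 1 + x / (1 - x) <= 1 + x / (1 - r)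
    <= expR (x / (1 - r))]. The exponents add up to a sum bounded in [N]. *)
Lemma psum_npart_le_bound r N M : 0 <= r < 1 ->
  psum (npart_le N) r M <= expR ((\sum_(1 <= i < N.+1) r ^+ i) / (1 - r)).
Proof.
move=> r01; have [r_ge0 r_lt1] := andP r01; elim: N => [|N IHN].
  rewrite big_geq // mul0r expR0 /psum.
  case: M => [|M]; first by rewrite big_geq.
  rewrite big_nat_recl // npart_le0 eqxx mul1r expr0 big1 ?addr0 // => n _.
  by rewrite npart_le0 mul0r.
have := psum_divr_le M r01 (ltn0Sn N) (npart_le_delay N).
move/le_trans; apply; rewrite big_nat_recr //= mulrDl expRD.
have x_lt1 : r ^+ N.+1 < 1 by rewrite exprn_ilt1.
apply: ler_pM => //.
- exact: psum_ge0.
- by rewrite invr_ge0 subr_ge0 ltW.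
apply: le_trans (expR_ge1Dx _).
have x_ge0 : 0 <= r ^+ N.+1 by exact: exprn_ge0.
have x_le : r ^+ N.+1 <= r by rewrite exprS ler_piMr // exprn_ile1 // ltW.
have -> : (1 - r ^+ N.+1)^-1 = 1 + r ^+ N.+1 / (1 - r ^+ N.+1).
  have x_neq1 : 1 - r ^+ N.+1 != 0 by rewrite gt_eqF // subr_gt0.
  by apply: (mulIf x_neq1); rewrite mulrDl mul1r divfK // mulVf // subrK.
rewrite lerD2l ler_wpM2l // lef_pV2 ?posrE ?subr_gt0 //.
by rewrite lerD2l lerN2.
Qed.

Lemma npart_bounded r : 0 <= r < 1 -> psum_bounded npart r.
Proof.
move=> r01; have [r_ge0 r_lt1] := andP r01.
exists (expR ((1 - r)^-1 / (1 - r))) => M.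
(* Below degree [M], bounding the parts by [M] excludes no partition. *)
apply: le_trans (_ : psum (npart_le M) r M <= _).
  rewrite /psum le_eqVlt; apply/orP; left; apply/eqP.
  by apply: eq_big_nat => n /andP[_ /ltnW /npart_le_full ->].
apply: le_trans (psum_npart_le_bound _ _ r01) _.
by rewrite ler_expR ler_wpM2r ?sum_exp_le // invr_ge0 subr_ge0 ltW.
Qed.

Lemma npart_le_cvg q N : normc q < 1 ->
  psum (npart_le N) q @ \oo --> (qpoch q N)^-1.
Proof.
move=> q_lt1; have r01 : 0 <= normc q < 1 by rewrite normc_ge0.
elim: N => [|N IHN].
  (* The sum with [M = 0] is empty; the shift leaves the constant sequence 1. *)
  rewrite /qpoch big_geq // invr1 -(cvg_shiftS (psum _ q)).
  rewrite (_ : [sequence _]_n = fun=> 1); first exact: cvg_cst.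
  apply/funext => M /=; rewrite /psum big_nat_recl // npart_le0 mul1r expr0.
  by rewrite big1 ?addr0 // => n _; rewrite npart_le0 mul0r.
have -> : (qpoch q N.+1)^-1 = (qpoch q N)^-1 / (1 - q ^+ N.+1).
  by rewrite /qpoch big_nat_recr //= invfM.
have bd : psum_bounded (npart_le N) (normc q).
  exists (expR ((\sum_(1 <= i < N.+1) normc q ^+ i) / (1 - normc q))) => M.
  exact: psum_npart_le_bound.
exact: psum_div_cvg q_lt1 (ltn0Sn N) (npart_le_delay N) bd IHN.
Qed.

(** Each factor has modulus at most [1 + normc q ^+ i <= expR (normc q ^+ i)]. *)
Lemma qpoch_bound q N : normc q < 1 ->
  normc (qpoch q N) <= expR ((1 - normc q)^-1).
Proof.
move=> q_lt1; have r01 : 0 <= normc q < 1 by rewrite normc_ge0.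
apply: (@le_trans _ _ (expR (\sum_(1 <= i < N.+1) normc q ^+ i))); last first.
  by rewrite ler_expR sum_exp_le.
elim: N => [|N IHN]; first by rewrite /qpoch !big_geq // expR0 normc1.
rewrite [X in expR X]big_nat_recr //= expRD.
rewrite /qpoch big_nat_recr //= normcM ler_pM ?normc_ge0 //.
apply: le_trans (expR_ge1Dx _); apply: le_trans (ler_normcD _ _) _.
by rewrite normc1 normcN normcX.
Qed.

Lemma qpoch_neq0 q N : normc q < 1 -> qpoch q N != 0.
Proof.
move=> q_lt1; rewrite /qpoch big_nat.
elim/big_ind : _ => [|x y|i /andP[i_gt0 _]].
- exact: oner_neq0.
- exact: mulf_neq0.
- exact: subr1X_neq0.
Qed.

(* Euler: the product being bounded, its reciprocal [l] cannot vanish. *)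
Lemma npart_cvg q : normc q < 1 ->
  exists l : Cplx R,
    [/\ psum npart q @ \oo --> l, l != 0 & qpoch q @ \oo --> l^-1].
Proof.
move=> q_lt1; have r01 : 0 <= normc q < 1 by rewrite normc_ge0.
have [l cl clV] := psum_cvg_dominated npart_le_leq npart_le_full
  (npart_bounded r01) (fun N => npart_le_cvg (N := N) q_lt1).
have l_neq0 : l != 0.
  apply/eqP => l0; rewrite l0 in clV.
  set c := expR ((1 - normc q)^-1).
  have /cvgC_distP /(_ c^-1) := clV.
  rewrite invr_gt0 expR_gt0 => /(_ isT) /filter_ex[N].
  rewrite sub0r normcN normcV ltf_pV2 ?posrE ?expR_gt0 //.
    by apply/negP; rewrite -leNgt qpoch_bound.
  rewrite lt0r normc_ge0 andbT; apply/eqP => /eq0_normc /eqP.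
  by rewrite (negPf (qpoch_neq0 _ q_lt1)).
exists l; split; [exact: cl|exact: l_neq0|].
have <- : (fun N => (qpoch q N)^-1^-1) = qpoch q.
  by apply/funext => N; rewrite invrK.
exact: cvgV l_neq0 clV.
Qed.

End Euler.

(** * The Lambert series *)

Section Lambert.
Variable R : realType.
Implicit Types (q : Cplx R) (r : R).

Lemma nb_parts_eq_delay m n : (0 < m)%N ->
  nb_parts_eq m n = (delay m npart n + delay m (nb_parts_eq m) n)%N.
Proof. by move=> m_gt0; rewrite nb_parts_eqE // /delay; case: ifP. Qed.

(** The factor [r ^+ m] is kept so that the bounds can be summed over [m]. *)
Lemma nb_parts_eq_bound r C m M : 0 <= r < 1 -> (0 < m)%N ->
  (forall N, psum npart r N <= C) ->
  psum (nb_parts_eq m) r M <= r ^+ m * (C / (1 - r)).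
Proof.
move=> r01 m_gt0 pC; have [r_ge0 r_lt1] := andP r01.
have nbE n := nb_parts_eq_delay n m_gt0.
apply: le_trans (psum_divr_le M r01 m_gt0 nbE) _.
have x_le : r ^+ m <= r.
  by rewrite -[m]prednK // exprS ler_piMr // exprn_ile1 // ltW.
have C_ge0 : 0 <= C := le_trans (psum_ge0 _ _ r_ge0) (pC 0%N).
rewrite psum_delay -mulrA ler_wpM2l ?exprn_ge0 //.
apply: ler_pM => //.
- exact: psum_ge0.
- by rewrite invr_ge0 subr_ge0 exprn_ile1 // ltW.
by rewrite lef_pV2 ?posrE ?subr_gt0 ?exprn_ilt1 -?lt0n // lerD2l lerN2.
Qed.

Lemma nb_parts_neq_bounded k r : 0 <= r < 1 ->
  psum_bounded (nb_parts_neq k) r.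
Proof.
move=> r01; have [r_ge0 r_lt1] := andP r01.
have [C pC] := npart_bounded r01.
have C_ge0 : 0 <= C := le_trans (psum_ge0 _ _ r_ge0) (pC 0%N).
have D_ge0 : 0 <= C / (1 - r) by rewrite divr_ge0 // subr_ge0 ltW.
exists ((1 - r)^-1 * (C / (1 - r))) => M.
apply: le_trans (_ : psum (nb_parts_neq_le k M) r M <= _).
  rewrite /psum le_eqVlt; apply/orP; left; apply/eqP.
  by apply: eq_big_nat => n /andP[_ /ltnW /nb_parts_neq_le_full ->].
apply: (@le_trans _ _ (\sum_(1 <= m < M.+1) r ^+ m * (C / (1 - r)))); last first.
  by rewrite -mulr_suml ler_wpM2r // sum_exp_le.
rewrite psum_sum big_mkcond big_nat [leRHS]big_nat.
apply: ler_sum => m /andP[m_gt0 _].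
by case: ifP => _; rewrite ?nb_parts_eq_bound // mulr_ge0 // exprn_ge0.
Qed.

(** For each [m] the recurrence, with source term [delay m npart], has sum
    [q ^+ m * l / (1 - q ^+ m)]; finitely many such limits are added. *)
Lemma nb_parts_neq_le_cvg k q N (l : Cplx R) : normc q < 1 ->
  psum npart q @ \oo --> l ->
  psum (nb_parts_neq_le k N) q @ \oo --> l * lambert_neq k q N.
Proof.
move=> q_lt1 cl; have r01 : 0 <= normc q < 1 by rewrite normc_ge0.
rewrite (_ : psum _ q = fun M => \sum_(1 <= m < N.+1 | m != k)
    psum (nb_parts_eq m) q M); last by apply/funext => M; rewrite psum_sum.
rewrite /lambert_neq mulr_sumr big_nat_cond.
under eq_fun do rewrite big_nat_cond.
apply: cvg_big => [|m]; first exact: add_continuous.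
case/andP=> /andP[m_gt0 _] _.
rewrite mulrA [l * _]mulrC.
apply: (psum_div_cvg q_lt1 m_gt0 (fun n => nb_parts_eq_delay n m_gt0)).
  have [C pC] := npart_bounded r01; exists C => M.
  rewrite psum_delay; apply: le_trans (pC (M - m)%N).
  by rewrite ler_piMl ?psum_ge0 ?normc_ge0 // exprn_ile1 ?normc_ge0 // ltW.
exact: psum_delay_cvg.
Qed.

End Lambert.

Theorem theorem2p9 (R : realType) (k : nat) (hk : (0 < k)%N) :
  (forall q : Cplx R, `|q| < 1 ->
     [/\ cvgn (qpoch q),
         qpoch_inf q != 0,
         cvgn (lambert_neq k q) &
         series (fun n : nat => (nuD_lt k n)%:R * q ^+ n) @ \oo -->
           (qpoch_inf q)^-1 * limn (lambert_neq k q)])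
  /\ (forall n : nat, nuD_lt k n = nb_parts_neq k n).
Proof.
split=> [q|n]; last exact: nuD_ltE.
rewrite normC_normc ltcR => q_lt1.
have r01 : 0 <= normc q < 1 by rewrite normc_ge0.
have [l [cl l_neq0 cP]] := npart_cvg q_lt1.
have [L cL clL] := psum_cvg_dominated (@nb_parts_neq_le_leq k)
  (@nb_parts_neq_le_full k) (nb_parts_neq_bounded k r01)
  (fun N => nb_parts_neq_le_cvg (N := N) q_lt1 cl).
(* Convergence of the Lambert sums is deduced from that of their multiples by the nonzero [l]. *)
have cLam : lambert_neq k q @ \oo --> l^-1 * L.
  rewrite (_ : lambert_neq k q = fun N => l^-1 * (l * lambert_neq k q N)).
    exact: cvgMl_tmp.
  by apply/funext => N; rewrite mulKf.
have Pinf : qpoch_inf q = l^-1 := norm_cvg_lim cP.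
split.
- exact: cvgP cP.
- by rewrite Pinf invr_neq0.
- exact: cvgP cLam.
rewrite Pinf invrK (norm_cvg_lim cLam) (mulVKf l_neq0).
have -> : series (fun n => (nuD_lt k n)%:R * q ^+ n) = psum (nb_parts_neq k) q.
  by apply/funext => M; apply: eq_bigr => n _; rewrite nuD_ltE.
exact: cL.
Qed.
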